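(* Fix an agent index $i$ and consider the system $\dot{\boldsymbol p}_i=\theta_i\boldsymbol u_i+\sum_{j=1}^N \boldsymbol d_{ij}\psi_j(t)+\boldsymbol\epsilon_i(t)$ with $\boldsymbol p_i,\boldsymbol u_i\in\mathbb R^2$, together with the function $h_i=h_i(\boldsymbol p_i,\boldsymbol z_i)$, the constants $\alpha_i,\bar\theta_i,\bar d_{ij},E,V_z$, the operator $\mathrm{Proj}$ and all standing assumptions as described in the context. Let $\mu>0$ and $\nu_i>0$ be constants, and define $$l_{\theta i}(\hat\theta)=\frac{\hat\theta^2-\bar\theta_i^2}{\bar\theta_i\alpha_i+(\alpha_i/2)^2}\quad(\hat\theta\in\mathbb R),\qquad l_{di}(\hat{\boldsymbol d}_{ij})=\frac{\hat{\boldsymbol d}_{ij}^\top\hat{\boldsymbol d}_{ij}-\bar d_{ij}^2}{2\nu_i\bar d_{ij}+\nu_i^2}\quad(\hat{\boldsymbol d}_{ij}\in\mathbb R^2).$$ Let the parameter estimates $\hat\theta_i(t)\in\mathbb R$ and $\hat{\boldsymbol d}_{ij}(t)\in\mathbb R^2$, $j=1,\dots,N$, be generated by the update laws $$\dot{\hat\theta}_i=\mathrm{Proj}\Big(\hat\theta_i,\,-\tfrac{1}{2K_i}\Big(\tfrac{\partial h_i}{\partial\boldsymbol p_i}\Big)^{\top}\boldsymbol u_i-\tfrac{\mu}{2}\hat\theta_i,\;l_{\theta i}\Big),$$ $$\dot{\hat{\boldsymbol d}}_{ij}=\mathrm{Proj}\Big(\hat{\boldsymbol d}_{ij},\,-\tfrac{1}{2Q_{ij}}\Big(\tfrac{\partial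 h_i}{\partial\boldsymbol p_i}\Big)\psi_j-\tfrac{\mu}{2}\hat{\boldsymbol d}_{ij},\;l_{di}\Big),$$ with $|\hat\theta_i(0)|\le\frac12$ and with positive constants $K_i,Q_{ij}$ satisfying $$K_i\le\frac{h_i(0)}{2\,(|\hat\theta_i(0)|+\bar\theta_i)^2},\qquad Q_{ij}\le\frac{h_i(0)}{2N(\|\hat{\boldsymbol d}_{ij}(0)\|+\bar d_{ij})^2}\quad(j=1,\dots,N),$$ where $h_i(0)=h_i(\boldsymbol p_i(0),\boldsymbol z_i(0))$. Set $$\zeta_i=\Big\|\frac{\partial h_i}{\partial\boldsymbol p_i}\Big\|E+\Big\|\frac{\partial h_i}{\partial\boldsymbol z_i}\Big\|V_z$$ and $$K_{bf}(\boldsymbol p_i,\hat\theta_i,\hat{\boldsymbol d}_{ij})=\Big\{\boldsymbol u_i\in\mathbb R^2:\ \Big(\frac{\partial h_i}{\partial\boldsymbol p_i}\Big)^{\top}\sum_{j=1}^N\hat{\boldsymbol d}_{ij}\psi_j+\Big(\hat\theta_i+\frac{1+\alpha_i}{2}\Big)\Big(\frac{\partial h_i}{\partial\boldsymbol p_i}\Big)^{\top}\boldsymbol u_i-\zeta_i+\frac{\mu}{2}\Big(h_i-K_i\bar\theta_i^2-\sum_{j=1}^NQ_{ij}\bar d_{ij}^2\Big)\ge0\Big\},$$ where $h_i$ and its partial derivatives are evaluated at the current $(\boldsymbol p_i,\boldsymbol z_i)$ and $\psi_j$ at the current time. Then any Lipschitz continuous controller $\boldsymbol u_i$ whose value along the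 closed-loop trajectory satisfies $\boldsymbol u_i\in K_{bf}(\boldsymbol p_i,\hat\theta_i,\hat{\boldsymbol d}_{ij})$ at every time guarantees the safety of $\mathcal C_i=\{\boldsymbol p_i:h_i\ge0\}$ for the system $\dot{\boldsymbol p}_i=\theta_i\boldsymbol u_i+\sum_{j=1}^N \boldsymbol d_{ij}\psi_j(t)+\boldsymbol\epsilon_i(t)$; that is, along every resulting closed-loop trajectory, $h_i(\boldsymbol p_i(t),\boldsymbol z_i(t))\ge0$ for all $t\ge0$ for which the trajectory is defined.
   Context: **System.** $\boldsymbol p_i(t)\in\mathbb R^2$ is the position of agent $i$ and $\boldsymbol u_i\in\mathbb R^2$ its control input. The agent obeys $\dot{\boldsymbol p}_i=\theta_i\boldsymbol u_i+\boldsymbol d_i(t)$, where $\boldsymbol d_i$ is an unknown continuous bounded disturbance, written as $\boldsymbol d_i(t)=\sum_{j=1}^N\boldsymbol d_{ij}\psi_j(t)+\boldsymbol\epsilon_i(t)$. Here $\boldsymbol d_{ij}\in\mathbb R^2$ are unknown constant vectors, $\psi_1,\dots,\psi_N:[0,\infty)\to\mathbb R$ are chosen (known, continuous) scalar basis functions (e.g. the Fourier basis $1,\cos\omega_l t,\sin\omega_l t$ with $\omega_l=2\pi l/T$, $l=1,\dots,(N-1)/2$, $N$ odd), and $\boldsymbol\epsilon_i(t)\in\mathbb R^2$ is the approximation error. **Actuator fault.** $\theta_i$ is an unknown constant with $\theta_i\in[\alpha_i,1]$, where $\alpha_i\in(0,1)$ is a known small constant. Put $\bar\theta_i=\frac{1-\alpha_i}{2}$.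 Then $\theta_i=\theta_i^*+\frac{1+\alpha_i}{2}$ with $\theta_i^*\in[-\bar\theta_i,\bar\theta_i]$. **Safety function.** $\boldsymbol z_i(t)\in\mathbb R^2$ is the position of the nearest detected neighbour of agent $i$, taken to be a differentiable function of time. $h_i=h_i(\boldsymbol p_i,\boldsymbol z_i)$ is a continuously differentiable real-valued function that has relative degree one with respect to the system (i.e. $\partial h_i/\partial\boldsymbol p_i\neq0$ where $h_i\ge0$). The choice used for collision avoidance is $h_i=\|\boldsymbol p_i-\boldsymbol z_i\|^2-(2r_{\mathrm{safe}})^2$, where $r_{\mathrm{safe}}>0$ is a safety radius. The partial derivatives $\partial h_i/\partial\boldsymbol p_i$ and $\partial h_i/\partial\boldsymbol z_i$ are regarded as column vectors in $\mathbb R^2$. **Bounds.** There are known positive constants $\bar d_{ij}$, $E$, $V_z$ with $\|\boldsymbol d_{ij}\|\le\bar d_{ij}$, $\|\boldsymbol\epsilon_i(t)\|\le E$ and $\|\dot{\boldsymbol z}_i(t)\|\le V_z$ for all $t$. $\|\cdot\|$ is the Euclidean norm. **Projection operator.** For vectors $\boldsymbol x,\boldsymbol y\in\mathbb R^k$ and a convex differentiable function $l:\mathbb R^k\to\mathbb R$, $$\mathrm{Proj}(\boldsymbol x,\boldsymbol y,l)=\begin{cases}\boldsymbol y-l(\boldsymbol x)\dfrac{\nabla l(\boldsymbol x)\nabla l(\boldsymbol x)^\top}{\|\nabla l(\boldsymbol x)\|^2}\boldsymbol y,&\text{if } l(\boldsymbol x)>0\text{ and }\boldsymbol y^\top\nabla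 l(\boldsymbol x)>0,\\ \boldsymbol y,&\text{otherwise.}\end{cases}$$ **Controller.** The controller is a feedback law, Lipschitz continuous in its arguments. It may use the state $\boldsymbol p_i$ and the other quantities entering $K_{bf}$, namely $\boldsymbol z_i$, $\hat\theta_i$, $\hat{\boldsymbol d}_{ij}$ and $t$. A closed-loop trajectory is a solution $(\boldsymbol p_i,\hat\theta_i,\hat{\boldsymbol d}_{i1},\dots,\hat{\boldsymbol d}_{iN})$ of the system together with the update laws. *)

(* Defs.v *)
From HB Require Import structures.
From mathcomp Require Import all_boot all_order all_algebra.
From mathcomp Require Import all_classical all_reals all_analysis.
Set Implicit Arguments.
Unset Strict Implicit.
Unset Printing Implicit Defensive.
Import Order.TTheory GRing.Theory Num.Theory.
Import numFieldNormedType.Exports.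
Local Open Scope classical_set_scope.
Local Open Scope ring_scope.

Section EuclideanSpace.
Context {R : realType}.

Definition dot k (x y : 'cV[R]_k) : R := (x^T *m y) 0 0.

(* The library norm `|x| on 'cV[R]_k is the maximum norm. *)
Definition enorm k (x : 'cV[R]_k) : R := Num.sqrt (dot x x).

Definition grad k (f : 'cV[R]_k -> R) (x : 'cV[R]_k) : 'cV[R]_k :=
  \col_i 'D_(delta_mx i 0) f x.

(* On a finite-dimensional V, continuity of every directional derivative is
   continuity of the differential. *)
Definition continuously_differentiable (V : normedModType R) (f : V -> R) :=
  (forall x, differentiable f x) /\ (forall v, continuous (fun x => 'D_v f x)).

(* v is the derivative of f at t relative to I: the two-sided derivative when
   t is interior to I, the one-sided one when t is an end point of I. *)
Definition is_derive_in (V : normedModType R) (I : set R) (f : R -> V)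
    (t : R) (v : V) :=
  (s - t)^-1 *: (f s - f t) @[s --> within I t^'] --> v.

Definition Proj k (x y : 'cV[R]_k) (l : 'cV[R]_k -> R) : 'cV[R]_k :=
  let g := grad l x in
  if (0 < l x) && (0 < dot y g)
  then y - l x *: (((enorm g ^+ 2)^-1 *: (g *m g^T)) *m y)
  else y.

(* Proj on R^1, with R^1 identified with R. *)
Definition Proj1 (x y : R) (l : R -> R) : R :=
  (Proj (x%:M : 'cV[R]_1) (y%:M : 'cV[R]_1) (fun v => l (v 0 0))) 0 0.

End EuclideanSpace.

Section SafeControl.
Context {R : realType} {N : nat}.

(* Column j of D is the coefficient vector of the basis function psi j. *)
Definition basis_sum (D : 'M[R]_(2, N)) (psi : 'I_N -> R -> R) (t : R)
    : 'cV[R]_2 :=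
  \sum_(j < N) psi j t *: col j D.

Definition theta_bar (alpha : R) : R := (1 - alpha) / 2.

Definition l_theta (alpha : R) (th : R) : R :=
  (th ^+ 2 - theta_bar alpha ^+ 2)
  / (theta_bar alpha * alpha + (alpha / 2) ^+ 2).

Definition l_d (nu dbar : R) (v : 'cV[R]_2) : R :=
  (dot v v - dbar ^+ 2) / (2 * nu * dbar + nu ^+ 2).

Definition grad_p (h : 'cV[R]_2 * 'cV[R]_2 -> R) (p z : 'cV[R]_2) : 'cV[R]_2 :=
  grad (fun q => h (q, z)) p.

Definition grad_z (h : 'cV[R]_2 * 'cV[R]_2 -> R) (p z : 'cV[R]_2) : 'cV[R]_2 :=
  grad (fun q => h (p, q)) z.

Definition zeta (h : 'cV[R]_2 * 'cV[R]_2 -> R) (E Vz : R) (p z : 'cV[R]_2)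
    : R :=
  enorm (grad_p h p z) * E + enorm (grad_z h p z) * Vz.

Definition K_bf (h : 'cV[R]_2 * 'cV[R]_2 -> R) (psi : 'I_N -> R -> R)
    (alpha mu E Vz K : R) (Q dbar : 'I_N -> R)
    (t : R) (z p : 'cV[R]_2) (th : R) (D : 'M[R]_(2, N)) : set 'cV[R]_2 :=
  [set u | 0 <= dot (grad_p h p z) (basis_sum D psi t)
                + (th + (1 + alpha) / 2) * dot (grad_p h p z) u
                - zeta h E Vz p z
                + mu / 2 * (h (p, z) - K * theta_bar alpha ^+ 2
                            - \sum_(j < N) Q j * dbar j ^+ 2)].

(* A feedback law maps (p, z, theta_hat, d_hat, t) to a control input. *)
Definition feedback_law : Type :=
  'cV[R]_2 * 'cV[R]_2 * R * 'M[R]_(2, N) * R -> 'cV[R]_2.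

(* Local Lipschitz continuity, which global Lipschitz continuity implies
   (lipschitz_locally). *)
Definition feedback_lipschitz (kappa : feedback_law) :=
  [locally [lipschitz kappa a | a in [set a | 0 <= a.2]]].

Definition feedback_input (kappa : feedback_law) (p z : R -> 'cV[R]_2)
    (th : R -> R) (D : R -> 'M[R]_(2, N)) (t : R) : 'cV[R]_2 :=
  kappa (p t, z t, th t, D t, t).

(* (p, th, D) solves, on the time interval I, the system under the input
   signal u together with the update laws; th and the columns of D are the
   estimates of theta^* and of the columns of d. *)
Definition closed_loop_trajectory (h : 'cV[R]_2 * 'cV[R]_2 -> R)
    (psi : 'I_N -> R -> R) (theta : R) (d : 'M[R]_(2, N))
    (eps z : R -> 'cV[R]_2) (alpha mu nu K : R) (Q dbar : 'I_N -> R)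
    (u : R -> 'cV[R]_2) (I : set R)
    (p : R -> 'cV[R]_2) (th : R -> R) (D : R -> 'M[R]_(2, N)) :=
  forall t, I t ->
    [/\ is_derive_in I p t (theta *: u t + basis_sum d psi t + eps t),
        is_derive_in I th t
          (Proj1 (th t)
             (- (2 * K)^-1 * dot (grad_p h (p t) (z t)) (u t)
              - mu / 2 * th t)
             (l_theta alpha))
      & forall j : 'I_N,
          is_derive_in I (fun s => col j (D s)) t
            (Proj (col j (D t))
               ((- (2 * Q j)^-1 * psi j t) *: grad_p h (p t) (z t)
                - (mu / 2) *: col j (D t))
               (l_d nu (dbar j)))].

End SafeControl.

(* Main.v *)
(* Subtract the weighted squared estimation errors from h:
     W = h - K (theta^* - th)^2 - \sum_j Q_j |d_j - D_j|^2.
   The gain bounds give W >= 0 at time 0. As l_theta and l_d are convex and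
   nonpositive at the true parameters, Proj only increases the scalar product
   of the update direction with the estimation error, so the update laws cancel
   the unknown parameters in W', and the condition u \in K_bf yields
   W' >= - (mu / 2) W. By Gronwall W, and hence h, stays nonnegative. *)
Require Import Defs.
From HB Require Import structures.
From mathcomp Require Import all_boot all_order all_algebra.
From mathcomp Require Import all_classical all_reals all_analysis.
From mathcomp Require Import ring lra.
Import Order.TTheory GRing.Theory Num.Theory.
Import numFieldNormedType.Exports.
Local Open Scope classical_set_scope.
Local Open Scope ring_scope.

(** * Euclidean inner product and norm on column vectors *)

Section Dot.
Context {R : realType} {k : nat}.
Implicit Types x y w : 'cV[R]_k.

Lemma dotE x y : dot x y = \sum_i x i 0 * y i 0.
Proof. by rewrite /dot mxE; apply: eq_bigr => i _; rewrite mxE. Qed.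

Lemma dotC x y : dot x y = dot y x.
Proof. by rewrite !dotE; apply: eq_bigr => i _; rewrite mulrC. Qed.

Lemma dotDr x y w : dot x (y + w) = dot x y + dot x w.
Proof. by rewrite /dot mulmxDr mxE. Qed.

Lemma dotZr a x y : dot x (a *: y) = a * dot x y.
Proof. by rewrite /dot -scalemxAr mxE. Qed.

Lemma dotNr x y : dot x (- y) = - dot x y.
Proof. by rewrite -scaleN1r dotZr mulN1r. Qed.

Lemma dotBr x y w : dot x (y - w) = dot x y - dot x w.
Proof. by rewrite dotDr dotNr. Qed.

Lemma dot0r x : dot x 0 = 0.
Proof. by rewrite -(scale0r 0) dotZr mul0r. Qed.

Lemma dotDl x y w : dot (y + w) x = dot y x + dot w x.
Proof. by rewrite !(dotC _ x) dotDr. Qed.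

Lemma dotZl a x y : dot (a *: y) x = a * dot y x.
Proof. by rewrite !(dotC _ x) dotZr. Qed.

Lemma dotBl x y w : dot (y - w) x = dot y x - dot w x.
Proof. by rewrite !(dotC _ x) dotBr. Qed.

Lemma dot_sumr (n : nat) x (f : 'I_n -> 'cV[R]_k) :
  dot x (\sum_j f j) = \sum_j dot x (f j).
Proof. by rewrite /dot mulmx_sumr summxE. Qed.

Lemma dot_ge0 x : 0 <= dot x x.
Proof. by rewrite dotE sumr_ge0// => i _; rewrite -expr2 sqr_ge0. Qed.

Lemma dot_eq0 x : (dot x x == 0) = (x == 0).
Proof.
apply/eqP/eqP => [|->]; last exact: dot0r.
rewrite dotE => /eqP; rewrite psumr_eq0 => [/allP h0|i _]; last first.
  by rewrite -expr2 sqr_ge0.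
apply/colP => i; rewrite mxE; apply/eqP.
by have := h0 i (mem_index_enum i); rewrite -expr2 sqrf_eq0.
Qed.

Lemma enorm_ge0 x : 0 <= enorm x.
Proof. exact: sqrtr_ge0. Qed.

Lemma sqr_enorm x : enorm x ^+ 2 = dot x x.
Proof. by rewrite sqr_sqrtr// dot_ge0. Qed.

(** The squares are compared: the squared norm of [dot y y *: x - dot x y *: y] is [dot y y] times
    the gap between the squares of the two sides, which settles the case [y != 0]. *)
Lemma cauchy_schwarz x y : `|dot x y| <= enorm x * enorm y.
Proof.
rewrite -(@ler_pXn2r _ 2%N) ?nnegrE ?mulr_ge0 ?enorm_ge0//.
rewrite real_normK ?num_real// exprMn !sqr_enorm.
have [->|y0] := eqVneq y 0; first by rewrite !dot0r expr0n mulr0.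
have yy : 0 < dot y y by rewrite lt_neqAle eq_sym dot_eq0 y0 dot_ge0.
have := dot_ge0 (dot y y *: x - dot x y *: y).
rewrite !(dotBl, dotBr, dotZl, dotZr) (dotC y x) => h0.
rewrite -subr_ge0 -(pmulr_rge0 _ yy); apply: le_trans h0 _; lra.
Qed.

(** Squared triangle inequality, with which the initial errors of the disturbance estimates are
    measured against the bounds on [Q]. *)
Lemma enormB_sqr x y : dot (x - y) (x - y) <= (enorm y + enorm x) ^+ 2.
Proof.
rewrite !(dotBl, dotBr) (dotC y x) sqrrD !sqr_enorm.
by have := cauchy_schwarz x y; rewrite ler_norml => /andP[]; lra.
Qed.

End Dot.

(** * The projection operator for quadratic [l] *)

Section Projection.
Context {R : realType} {k : nat}.
Implicit Types x y w : 'cV[R]_k.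

(** Both [l_theta] (read on ['cV[R]_1]) and [l_d] have this shape. Along a basis vector [e] the
    difference quotient is exactly affine in the step [s], with slope [dot e e / c]. *)
Lemma grad_quadratic (l : 'cV[R]_k -> R) (b c : R) x :
  (forall v, l v = (dot v v - b) / c) -> grad l x = (2 / c) *: x.
Proof.
move=> lE; apply/colP => i; rewrite !mxE.
set e := delta_mx i 0.
have xi : dot x e = x i 0.
  rewrite dotE (bigD1 i)//= mxE !eqxx mulr1 big1 ?addr0// => j ji.
  by rewrite mxE (negbTE ji) mulr0.
have slim : 2 / c * x i 0 + s * (dot e e / c) @[s --> (0 : R)^']
    --> 2 / c * x i 0 + 0 * (dot e e / c).
  apply: cvgD; first exact: cvg_cst.
  by apply: cvgM; [exact: nbhs_dnbhs | exact: cvg_cst].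
rewrite mul0r addr0 in slim.
apply: cvg_lim; first exact: norm_hausdorff.
apply: cvg_trans slim; apply: near_eq_cvg; near=> s => /=.
have s0 : s != 0 by near: s; exact: nbhs_dnbhs_neq.
rewrite -[RHS]/(s^-1 * _) !lE/= !(dotDl, dotDr, dotZl, dotZr) (dotC e x) xi.
by move: c^-1 => c'; field.
Unshelve. all: by end_near. Qed.

(** The correction is active only when [x] is outside the ball that contains [w]. There the gradient
    [g] has a nonpositive product with [w - x], and [Proj] subtracts a nonnegative multiple of
    [g]. *)
Lemma Proj_dot_ge (l : 'cV[R]_k -> R) (b c : R) x y w :
  0 < c -> (forall v, l v = (dot v v - b ^+ 2) / c) -> dot w w <= b ^+ 2 ->
  dot (w - x) y <= dot (w - x) (Proj x y l).
Proof.
move=> c0 lE wb; rewrite /Proj (grad_quadratic l (b ^+ 2) c)//; cbv zeta.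
case: ifPn => // /andP[l0].
have : dot (w - x) ((2 / c) *: x) <= 0.
  rewrite dotZr mulr_ge0_le0 ?divr_ge0 ?ltW// dotBl.
  have : b ^+ 2 < dot x x.
    by move: l0; rewrite lE pmulr_lgt0 ?invr_gt0// subr_gt0.
  (* Polarization: [2 (w - x).x = |w|^2 - |x|^2 - |w - x|^2], where [|w|^2 <= b^2 < |x|^2]. *)
  have := dot_ge0 (w - x); rewrite !(dotBl, dotBr) (dotC x w); lra.
move: (_ *: x) => g gwx yg.
have gg : g *m g^T *m y = dot y g *: g.
  by rewrite -mulmxA (mx11_scalar (g^T *m y)) mul_mx_scalar -[_ 0 0]/(dot g y) dotC.
rewrite -scalemxAl gg dotBr !dotZr lerBrDr gerDl.
apply: mulr_ge0_le0; first exact: ltW.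
apply: mulr_ge0_le0; first by rewrite invr_ge0 sqr_ge0.
by apply: mulr_ge0_le0; first exact: ltW.
Qed.
End Projection.

(** * Relative derivatives, the chain rule and Gronwall's lemma *)

Section DeriveIn.
Context {R : realType}.

(** Near [t], [f s] is [f t] plus [s - t] times a convergent quotient. The subset [J] lets
    derivatives taken along the whole domain of a trajectory give continuity on a compact
    subinterval, end points included. *)
Lemma is_derive_in_cvg (V : normedModType R) (I J : set R) (f : R -> V) t v :
  J `<=` I -> is_derive_in I f t v ->
  f s @[s --> within J (nbhs t)] --> f t.
Proof.
move=> JI fv.
(* The derivative only speaks of [s != t]; at [s = t] the value [f t] lies in each of its own
   neighbourhoods. *)
suff ft : f s @[s --> within I t^'] --> f t.
  move=> A At.
  have : \forall s \near t, s != t -> I s -> A (f s) := ft A At.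
  suff : (\forall s \near t, s != t -> I s -> A (f s)) ->
    (\forall s \near t, J s -> A (f s)) by [].
  apply: filterS => s sA /JI Is.
  have [->|st] := eqVneq s t; first exact: nbhs_singleton.
  exact: sA.
apply: (@cvg_trans _
  ((fun s => f t + (s - t) *: ((s - t)^-1 *: (f s - f t))) @ within I t^')).
  apply: near_eq_cvg; apply: cvg_within; near=> s.
  have st : s - t != 0 by rewrite subr_eq0; near: s; exact: nbhs_dnbhs_neq.
  by rewrite scalerA mulfV// scale1r subrKC.
rewrite -[in nbhs (f t)](addr0 (f t)) -(scale0r v) -(subrr t).
apply: cvgD; first exact: cvg_cst.
apply: cvgZ => //; apply: cvg_within_filter.
by apply: cvgB; [exact: nbhs_dnbhs | exact: cvg_cst].
Unshelve. all: by end_near. Qed.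

(** When [I] is a neighbourhood of [t], restricting to it does not change the limit; translating by
    [t] then gives the increment at 0 used by [derive]. *)
Lemma is_derive_in_is_derive (V : normedModType R) (I : set R) (f : R -> V) t v :
  (\forall s \near t, I s) -> is_derive_in I f t v -> is_derive t 1 f v.
Proof.
move=> It fv.
have fv' : (s - t)^-1 *: (f s - f t) @[s --> t^'] --> v.
  move=> A /fv AI.
  have {}AI : \forall s \near t^', I s -> A ((s - t)^-1 *: (f s - f t)) := AI.
  have It' : \forall s \near t^', I s by exact: nbhs_dnbhs.
  by apply: filterS2 AI It' => s; apply.
have fv0 : s^-1 *: ((f \o shift t) (s *: 1) - f t) @[s --> 0^'] --> v.
  move=> A /fv' AI.
  have {}AI : \forall s \near t, s != t -> A ((s - t)^-1 *: (f s - f t)) := AI.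
  suff A0 : \forall s \near (0 : R), s != 0 ->
    A (s^-1 *: ((f \o shift t) (s *: 1) - f t)) by exact: A0.
  move: AI.
  rewrite (near_shift 0) subr0; apply: filterS => s /= sA s0.
  rewrite [s%:A]mulr1; move: sA; rewrite addrK; apply.
  by rewrite -subr_eq0 addrK.
apply: DeriveDef; first by apply/cvg_ex; exists v.
exact: cvg_lim fv0.
Qed.

Lemma cvg_dot (T : Type) (F : set_system T) (FF : Filter F) (k : nat)
    (f g : T -> 'cV[R]_k) a b :
  f @ F --> a -> g @ F --> b -> dot (f x) (g x) @[x --> F] --> dot a b.
Proof.
move=> fa gb; under eq_fun do rewrite dotE; rewrite dotE.
apply: cvg_big => [|i _]; first exact: add_continuous.
have coord (c : 'cV[R]_k) (u : T -> 'cV[R]_k) : u @ F --> c ->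
    u x i 0 @[x --> F] --> c i 0.
  by move=> uc; exact: cvg_comp uc (@coord_continuous _ _ _ i 0 c).
by apply: cvgM; exact: coord.
Qed.

(** A difference of squares factors: the increment of [|a - c|^2] is
    [(c s - c t).(c s + c t - 2 a)], so the limit is that of an inner product, at end points as
    well. *)
Lemma is_derive_in_sqdist (k : nat) (I : set R) (c : R -> 'cV[R]_k) t
    (a v : 'cV[R]_k) :
  is_derive_in I c t v ->
  is_derive_in I (fun s => dot (a - c s) (a - c s)) t (- (2 * dot (a - c t) v)).
Proof.
move=> cv; rewrite /is_derive_in.
have -> : - (2 * dot (a - c t) v) = dot v (c t + c t - 2 *: a).
  by rewrite dotC !(dotBr, dotDr, dotNr, dotZr); ring.
have dlim : dot ((s - t)^-1 *: (c s - c t)) (c s + c t - 2 *: a)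
    @[s --> within I t^'] --> dot v (c t + c t - 2 *: a).
  apply: cvg_dot => //; apply: cvgB; last exact: cvg_cst.
  apply: cvgD; last exact: cvg_cst.
  apply: cvg_trans (is_derive_in_cvg _ _ _ _ _ _ (@subset_refl _ I) cv).
  by apply: cvg_app => A; exact: nbhs_dnbhs.
apply: cvg_trans dlim; apply: near_eq_cvg; apply: nearW => s.
rewrite -[RHS]/((s - t)^-1 * _) dotZl !(dotBl, dotBr, dotDr, dotNr, dotZr).
by rewrite (dotC (c s) a) (dotC (c t) a) (dotC (c t) (c s)); ring.
Qed.

Lemma col_sum_delta (k : nat) (v : 'cV[R]_k) :
  v = \sum_i v i 0 *: delta_mx i 0.
Proof.
by rewrite {1}(matrix_sum_delta v); apply: eq_bigr => i _; rewrite big_ord1.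
Qed.

(** Split [(v, w)] into [(v, 0) + (0, w)] and expand each part in the standard basis. On a basis
    vector the differential is a directional derivative of [h], which is a partial derivative of a
    slice because the other argument stays fixed. *)
Lemma diff_grad (k m : nat) (h : 'cV[R]_k * 'cV[R]_m -> R) x y v w :
  differentiable h (x, y) ->
  'd h (x, y) (v, w) = dot (grad (fun q => h (q, y)) x) v
                       + dot (grad (fun q => h (x, q)) y) w.
Proof.
move=> dh.
have -> : (v, w) = (v, 0) + (0, w) :> 'cV[R]_k * 'cV[R]_m.
  by rewrite -[RHS]/(v + 0, 0 + w) addr0 add0r.
have dl : 'd h (x, y) (v, 0) = dot (grad (fun q => h (q, y)) x) v.
  have -> : (v, 0) = \sum_i v i 0 *: (delta_mx i 0, 0)
      :> 'cV[R]_k * 'cV[R]_m.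
    rewrite {1}(col_sum_delta k v).
    elim/big_ind2 : _ => // [a1 a2 b1 b2 <- <-|i _].
      by rewrite -[RHS]/(_ + _, 0 + 0) addr0.
    by rewrite -[RHS]/(_, _ *: 0) scaler0.
  rewrite linear_sum dotE; apply: eq_bigr => i _.
  rewrite linearZ /= mxE mulrC -deriveE//; congr (_ * _).
  rewrite /derive; congr (lim (_ @ 0^')); apply/funext => s /=.
  by rewrite -[_ *: (_, _) + _]/(_ + _, s *: 0 + y) scaler0 add0r.
have dr : 'd h (x, y) (0, w) = dot (grad (fun q => h (x, q)) y) w.
  have -> : (0, w) = \sum_i w i 0 *: (0, delta_mx i 0)
      :> 'cV[R]_k * 'cV[R]_m.
    rewrite {1}(col_sum_delta m w).
    elim/big_ind2 : _ => // [a1 a2 b1 b2 <- <-|i _].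
      by rewrite -[RHS]/(0 + 0, _ + _) addr0.
    by rewrite -[RHS]/(_ *: 0, _) scaler0.
  rewrite linear_sum dotE; apply: eq_bigr => i _.
  rewrite linearZ /= mxE mulrC -deriveE//; congr (_ * _).
  rewrite /derive; congr (lim (_ @ 0^')); apply/funext => s /=.
  by rewrite -[_ *: (_, _) + _]/(s *: 0 + x, _ + _) scaler0 add0r.
by rewrite linearD dl dr.
Qed.

Lemma is_derive_comp2 (k m : nat) (h : 'cV[R]_k * 'cV[R]_m -> R) (t : R)
    (p : R -> 'cV[R]_k) (z : R -> 'cV[R]_m) pv zv :
  differentiable h (p t, z t) -> is_derive t 1 p pv -> is_derive t 1 z zv ->
  is_derive t 1 (fun s => h (p s, z s))
    (dot (grad (fun q => h (q, z t)) (p t)) pv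
     + dot (grad (fun q => h (p t, q)) (z t)) zv).
Proof.
move=> dh [/derivable1_diffP dp pE] [/derivable1_diffP dz zE].
have dpz := differentiable_pair dp dz.
have dhpz : differentiable (h \o (fun s => (p s, z s))) t.
  exact: differentiable_comp.
apply: DeriveDef; first exact/derivable1_diffP.
rewrite -[fun s => _]/(h \o (fun s => (p s, z s))) deriveE// diff_comp//=.
by rewrite diff_pair//= diff_grad// -!deriveE// pE zE.
Qed.

(* Gronwall's lemma, by monotonicity of [expR (c * s) * W s]. *)
Lemma ge0_of_derive_ge (W : R -> R) (c a b : R) :
  a <= b -> {within `[a, b], continuous W} ->
  (forall s, s \in `]a, b[ ->
     exists2 w, is_derive s 1 W w & - c * W s <= w) ->
  0 <= W a -> 0 <= W b.
Proof.
move=> ab Wc dW Wa.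
pose G (s : R) : R := expR (c * s) * W s.
have dE (s : R) : is_derive s (1 : R) (fun s => expR (c * s) : R) (expR (c * s) * c).
  apply: is_derive_eq; rewrite /GRing.scale/=; ring.
suff : G a <= G b.
  move=> Gab; rewrite -(pmulr_rge0 _ (expR_gt0 (c * b))).
  by apply: le_trans Gab; rewrite mulr_ge0// expR_ge0.
have dG (s : R) : s \in `]a, b[ ->
    exists2 g, is_derive s 1 G g & 0 <= g.
  move=> /dW[w Ww cw].
  exists (expR (c * s) * (w + c * W s)); last first.
    by rewrite mulr_ge0 ?expR_ge0//; lra.
  by apply: is_derive_eq; rewrite /GRing.scale/=; ring.
apply: (@ger0_derive1_le_cc _ G a b) => //.
- by move=> s /dG[g [? _] _].
- by move=> s /dG[g [? gE] g0]; rewrite derive1E gE.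
- apply/subspace_continuousP => s sab; apply: cvgM; last first.
    by move/subspace_continuousP : Wc; exact.
  apply: cvg_within_filter.
  have : {for s, continuous (fun s => expR (c * s) : R)}.
    by apply: differentiable_continuous; apply/derivable1_diffP; have [] := dE s.
  exact.
- by rewrite in_itv/= lexx ab.
- by rewrite in_itv/= lexx ab.
Qed.

End DeriveIn.

(** * The derivative of the barrier [W] under the update laws *)

Section SafeControlTheory.
Context {R : realType} {N : nat}.

(** The case [k = 1] of [Proj_dot_ge], where [dot] is the ordinary product; [0 < alpha < 1] makes
    the denominator of [l_theta] positive. *)
Lemma Proj1_l_theta_ge (alpha x y w : R) :
  0 < alpha < 1 -> `|w| <= theta_bar alpha ->
  (w - x) * y <= (w - x) * Proj1 x y (l_theta alpha).
Proof.
move=> /andP[a0 a1] wb.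
have dot1 (u v : 'cV[R]_1) : dot u v = u 0 0 * v 0 0 by rewrite dotE big_ord1.
have := @Proj_dot_ge R 1 (fun v => l_theta alpha (v 0 0)) (theta_bar alpha)
  (theta_bar alpha * alpha + (alpha / 2) ^+ 2) x%:M y%:M w%:M.
rewrite !dot1 /Proj1 !mxE /= !mulr1n; apply.
- rewrite /theta_bar; nra.
- by move=> v; rewrite /l_theta dot1 expr2.
- rewrite -expr2 -real_normK ?num_real//.
  by rewrite ler_sqr ?nnegrE// (le_trans _ wb).
Qed.

Lemma Proj_l_d_ge (nu dbar : R) (x y w : 'cV[R]_2) :
  0 < nu -> 0 < dbar -> enorm w <= dbar ->
  dot (w - x) y <= dot (w - x) (Proj x y (l_d nu dbar)).
Proof.
move=> nu0 d0 wd.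
apply: (@Proj_dot_ge R 2 _ dbar (2 * nu * dbar + nu ^+ 2)) => //.
  by rewrite addr_gt0 ?mulr_gt0 ?exprn_gt0.
by rewrite -sqr_enorm ler_sqr ?nnegrE ?enorm_ge0// ltW.
Qed.

Lemma dot_basis_sum (g : 'cV[R]_2) (D : 'M[R]_(2, N)) (psi : 'I_N -> R -> R) t :
  dot g (basis_sum D psi t) = \sum_j psi j t * dot g (col j D).
Proof. by rewrite dot_sumr; apply: eq_bigr => j _; rewrite dotZr. Qed.

(* [ts] is the true parameter theta^*. *)
Lemma barrier_derivative_ge (h : 'cV[R]_2 * 'cV[R]_2 -> R)
    (psi : 'I_N -> R -> R) (alpha mu nu E Vz K ts th t : R)
    (Q dbar : 'I_N -> R) (p z u eps zdot : 'cV[R]_2) (d D : 'M[R]_(2, N)) :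
  0 < alpha < 1 -> 0 < mu -> 0 < nu -> 0 < K -> (forall j, 0 < Q j) ->
  (forall j, 0 < dbar j) -> `|ts| <= theta_bar alpha ->
  (forall j, enorm (col j d) <= dbar j) -> enorm eps <= E -> enorm zdot <= Vz ->
  K_bf h psi alpha mu E Vz K Q dbar t z p th D u ->
  - (mu / 2) * (h (p, z) - K * (ts - th) ^+ 2
      - \sum_j Q j * dot (col j d - col j D) (col j d - col j D))
  <= dot (grad_p h p z) ((ts + (1 + alpha) / 2) *: u + basis_sum d psi t + eps)
     + dot (grad_z h p z) zdot
     + 2 * K * ((ts - th) * Proj1 th
         (- (2 * K)^-1 * dot (grad_p h p z) u - mu / 2 * th) (l_theta alpha))
     + \sum_j 2 * Q j * dot (col j d - col j D)
         (Proj (col j D) ((- (2 * Q j)^-1 * psi j t) *: grad_p h p z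
            - (mu / 2) *: col j D) (l_d nu (dbar j))).
Proof.
move=> ha mu0 nu0 K0 Q0 db0 tsb db epsE zV.
rewrite /K_bf/= /zeta; set g := grad_p h p z; set gz := grad_z h p z => hK.
(* Worst case of the approximation error and of the neighbour's velocity; the two instances below
   add up to [- zeta]. *)
have CS (a b : 'cV[R]_2) c : enorm b <= c -> - (enorm a * c) <= dot a b.
  move=> bc; have := cauchy_schwarz a b; rewrite ler_norml => /andP[+ _].
  by apply: le_trans; rewrite lerN2 ler_wpM2l ?enorm_ge0.
have geps := CS g _ _ epsE.
have gzd := CS gz _ _ zV.
(* The weight [2 * K] cancels the gain [(2 * K)^-1] of the update law, leaving
   [- (ts - th) * dot g u] to offset the unknown part of the actuator gain. *)
have thP : - (ts - th) * dot g u
    + mu / 2 * K * ((ts - th) ^+ 2 - theta_bar alpha ^+ 2)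
    <= 2 * K * ((ts - th) * Proj1 th
         (- (2 * K)^-1 * dot g u - mu / 2 * th) (l_theta alpha)).
  have mK : 0 < mu / 2 * K by rewrite mulr_gt0 ?divr_gt0.
  have K2 : 0 <= 2 * K by lra.
  apply: le_trans (ler_wpM2l K2 (@Proj1_l_theta_ge alpha th _ ts ha tsb)).
  have -> : 2 * K * ((ts - th) * (- (2 * K)^-1 * dot g u - mu / 2 * th))
      = - (ts - th) * dot g u - mu * K * ((ts - th) * th).
    by field; rewrite gt_eqF.
  rewrite lerD2l.
  have ts2 : ts ^+ 2 <= theta_bar alpha ^+ 2.
    by rewrite -real_normK ?num_real// ler_sqr ?nnegrE// (le_trans _ tsb).
  (* The leakage term [- mu / 2 * th] is split by [2 (ts - th) th = ts^2 - th^2 - (ts - th)^2];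
     dropping [th^2] and bounding [ts^2] yields the [theta_bar] term of [K_bf]. *)
  have -> : - (mu * K * ((ts - th) * th)) =
    mu / 2 * K * (th ^+ 2 + (ts - th) ^+ 2 - ts ^+ 2) by field.
  by rewrite ler_wpM2l ?(ltW mK)//; have := sqr_ge0 th; lra.
(* The same computation for each disturbance coefficient, with inner products in place of
   products. *)
have DP j : - (psi j t * dot g (col j d - col j D))
    + mu / 2 * (Q j * dot (col j d - col j D) (col j d - col j D)
                - Q j * dbar j ^+ 2)
    <= 2 * Q j * dot (col j d - col j D)
         (Proj (col j D) ((- (2 * Q j)^-1 * psi j t) *: g
            - (mu / 2) *: col j D) (l_d nu (dbar j))).
  have Q2 : 0 <= 2 * Q j by have := Q0 j; lra.
  apply: le_trans (ler_wpM2l Q2 (@Proj_l_d_ge nu _ (col j D) _ _ nu0 (db0 j) (db j))).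
  rewrite [in leRHS]dotBr !dotZr (dotC _ g).
  set e := col j d - col j D; set gd := dot g e.
  have -> : 2 * Q j * (- (2 * Q j)^-1 * psi j t * gd - mu / 2 * dot e (col j D))
      = - (psi j t * gd) - mu * Q j * dot e (col j D).
    by field; rewrite gt_eqF.
  rewrite lerD2l -mulrBr mulrA.
  have d2 : dot (col j d) (col j d) <= dbar j ^+ 2.
    by rewrite -sqr_enorm ler_sqr ?nnegrE ?enorm_ge0// ltW.
  have -> : - (mu * Q j * dot e (col j D)) = mu / 2 * Q j *
      (dot (col j D) (col j D) + dot e e - dot (col j d) (col j d)).
    by rewrite /e !(dotBl, dotBr) (dotC (col j D) (col j d)); field.
  have mQ : 0 < mu / 2 * Q j by rewrite mulr_gt0 ?divr_gt0.
  by rewrite ler_wpM2l ?(ltW mQ)//; have := dot_ge0 (col j D); lra.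
have : \sum_j _ <= \sum_j _ := ler_sum _ (fun j _ => DP j).
rewrite big_split/= sumrN -mulr_sumr sumrB.
have -> : \sum_j psi j t * dot g (col j d - col j D)
    = dot g (basis_sum d psi t) - dot g (basis_sum D psi t).
  rewrite !dot_basis_sum -sumrB; apply: eq_bigr => j _.
  by rewrite dotBr mulrBr.
(* The error terms turn [ts] into [th] and [d] into [D], so that the [K_bf] inequality applies; the
   remaining quadratic errors complete [h] to [W]. *)
rewrite !dotDr dotZr.
lra.
Qed.

End SafeControlTheory.

(** * Safety of the closed loop *)

Theorem theorem1 (R : realType) (N : nat)
  (alpha theta mu nu E Vz K : R) (dbar Q : 'I_N -> R)
  (psi : 'I_N -> R -> R) (d : 'M[R]_(2, N)) (eps : R -> 'cV[R]_2)
  (z zdot : R -> 'cV[R]_2)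
  (h : 'cV[R]_2 * 'cV[R]_2 -> R)
  (kappa : @feedback_law R N)
  (I : set R) (p : R -> 'cV[R]_2) (th : R -> R) (D : R -> 'M[R]_(2, N))
  (halpha : 0 < alpha < 1) (htheta : alpha <= theta <= 1)
  (hmu : 0 < mu) (hnu : 0 < nu) (hE : 0 < E) (hVz : 0 < Vz)
  (hdbar : forall j, 0 < dbar j)
  (hpsi : forall j, {within `[0, +oo[, continuous (psi j)})
  (hdist_cont :
     {within `[0, +oo[, continuous (fun t => basis_sum d psi t + eps t)})
  (hdist_bounded : [bounded basis_sum d psi t + eps t | t in `[0, +oo[])
  (hd : forall j, enorm (col j d) <= dbar j)
  (heps : forall t, 0 <= t -> enorm (eps t) <= E)
  (hz : forall t, 0 <= t -> is_derive_in `[0, +oo[ z t (zdot t))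
  (hzdot : forall t, 0 <= t -> enorm (zdot t) <= Vz)
  (hC1 : continuously_differentiable h)
  (hreldeg : forall p z, 0 <= h (p, z) -> grad_p h p z != 0)
  (hK : 0 < K) (hQ : forall j, 0 < Q j)
  (hkappa : feedback_lipschitz kappa)
  (hI : is_interval I) (hI0 : I 0) (hIge0 : forall t, I t -> 0 <= t)
  (htraj : closed_loop_trajectory h psi theta d eps z alpha mu nu K Q dbar
             (feedback_input kappa p z th D) I p th D)
  (hth0 : `|th 0| <= 1 / 2)
  (hKle : K <= h (p 0, z 0) / (2 * (`|th 0| + theta_bar alpha) ^+ 2))
  (hQle : forall j,
     Q j <= h (p 0, z 0) / (2 * N%:R * (enorm (col j (D 0)) + dbar j) ^+ 2))
  (hKbf : forall t, I t ->
     K_bf h psi alpha mu E Vz K Q dbar t (z t) (p t) (th t) (D t)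
       (feedback_input kappa p z th D t)) :
  forall t, I t -> 0 <= h (p t, z t).
Proof.
move=> t It.
(* Centring [theta] at the midpoint of [[alpha, 1]] leaves an offset of at most half the length,
   [theta_bar alpha]. *)
pose ts := theta - (1 + alpha) / 2.
have tsb : `|ts| <= theta_bar alpha.
  by rewrite ler_norml /ts /theta_bar; case/andP: htheta; lra.
pose W s := h (p s, z s) - K * (ts - th s) ^+ 2
  - \sum_j Q j * dot (col j d - col j (D s)) (col j d - col j (D s)).
have t0 := hIge0 _ It.
have tbar0 : 0 < theta_bar alpha by case/andP: halpha; rewrite /theta_bar; lra.
(* The initial value of [h] is a budget: half of it pays for the error in [theta], the other half
   for the [N] disturbance errors in equal shares. *)
have h0K : K * (`|th 0| + theta_bar alpha) ^+ 2 <= h (p 0, z 0) / 2.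
  have A0 : 0 < (`|th 0| + theta_bar alpha) ^+ 2.
    by rewrite exprn_gt0// ltr_wpDl.
  have A20 : 0 < 2 * (`|th 0| + theta_bar alpha) ^+ 2 by rewrite mulr_gt0.
  by have := hKle; rewrite (ler_pdivlMr _ _ A20); lra.
(* Initial safety is forced by [0 < K] together with the upper bound on [K]. *)
have h0 : 0 <= h (p 0, z 0).
  have : 0 <= K * (`|th 0| + theta_bar alpha) ^+ 2.
    by rewrite mulr_ge0 ?sqr_ge0// ltW.
  by move: h0K; lra.
have hQ0 : \sum_j Q j * (enorm (col j (D 0)) + dbar j) ^+ 2 <= h (p 0, z 0) / 2.
  (* For [N = 0] the share [h (p 0, z 0) / (2 * N%:R)] would divide by zero; the sum is then
     empty. *)
  have [N0|N0] := posnP N.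
    by rewrite big1 ?divr_ge0// => j _; have := ltn_ord j; rewrite [X in (_ < X)%N]N0.
  have -> : h (p 0, z 0) / 2 = \sum_(j < N) h (p 0, z 0) / (2 * N%:R).
    rewrite sumr_const card_ord -[RHS]mulr_natr.
    by field; rewrite pnatr_eq0 -lt0n.
  apply: ler_sum => j _.
  have B0 : 0 < (enorm (col j (D 0)) + dbar j) ^+ 2.
    by rewrite exprn_gt0// ltr_wpDl ?enorm_ge0.
  have N20 : 0 < 2 * N%:R :> R by rewrite mulr_gt0 ?ltr0n.
  have B20 := mulr_gt0 N20 B0.
  have := hQle j; rewrite (ler_pdivlMr _ _ B20).
  by rewrite ler_pdivlMr// [2 * _ * _]mulrC mulrA.
have W0 : 0 <= W 0.
  have h1 : K * (ts - th 0) ^+ 2 <= K * (`|th 0| + theta_bar alpha) ^+ 2.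
    rewrite ler_pM2l// -real_normK ?num_real// ler_sqr ?nnegrE//; last first.
      by rewrite addr_ge0// ltW.
    by rewrite (le_trans (ler_normB _ _))// addrC lerD2l.
  have h2 : \sum_j Q j * dot (col j d - col j (D 0)) (col j d - col j (D 0))
      <= \sum_j Q j * (enorm (col j (D 0)) + dbar j) ^+ 2.
    apply: ler_sum => j _; rewrite ler_pM2l//.
    apply: le_trans (enormB_sqr _ _) _.
    have dj0 := ltW (hdbar j).
    by rewrite ler_sqr ?nnegrE ?addr_ge0 ?enorm_ge0// lerD2l.
  by rewrite /W; lra.
have dh q : differentiable h q by case: hC1.
have J s : s \in `[0, t] -> I s.
  by rewrite in_itv/= => st; exact: (hI _ _ hI0 It).
have Wt : 0 <= W t.
  (* Relative derivatives give continuity on the closed interval; at interior times they become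
     two-sided derivatives. *)
  apply: (ge0_of_derive_ge W (mu / 2) 0 t) => //.
  - apply/subspace_continuousP => s /= st.
    have Is := J _ st.
    have [dp dth dD] := htraj _ Is.
    have JI : `[0, t] `<=` I by move=> x; exact: J.
    have pc := is_derive_in_cvg _ _ _ _ _ _ JI dp.
    have thc := is_derive_in_cvg _ _ _ _ _ _ JI dth.
    have zc : z x @[x --> within `[0, t] (nbhs s)] --> z s.
      apply: is_derive_in_cvg (hz s _); last exact: hIge0.
      by move=> x /=; rewrite !in_itv/= => /andP[->].
    have Dc j := is_derive_in_cvg _ _ _ _ _ _ JI (dD j).
    rewrite /W; apply: cvgB; first apply: cvgB.
    + have hc : {for (p s, z s), continuous h} by exact: differentiable_continuous.
      have pzc : (p x, z x) @[x --> within `[0, t] (nbhs s)] --> (p s, z s).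
        exact: (@cvg_pair _ _ _ _ (nbhs (p s)) (nbhs (z s))).
      exact: cvg_comp pzc hc.
    + apply: cvgM; first exact: cvg_cst.
      by under eq_fun do rewrite expr2; rewrite expr2; apply: cvgM;
        (apply: cvgB; [exact: cvg_cst | exact: thc]).
    + apply: cvg_big => [|j _]; first exact: add_continuous.
      apply: cvgM; first exact: cvg_cst.
      by apply: cvg_dot; (apply: cvgB; [exact: cvg_cst | exact: Dc]).
  - move=> s st.
    have /andP[s0 s1] : 0 < s < t by move: st; rewrite in_itv.
    have Is : I s by apply: J; rewrite in_itv/= !ltW.
    have [dp dth dD] := htraj _ Is.
    have nI : \forall x \near s, I x.
      have := near_in_itvoo st; apply: filterS => x; rewrite in_itv/= => /andP[x0 x1].
      by apply: J; rewrite in_itv/= !ltW.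
    have n0 : \forall x \near s, [set` `[0, +oo[] x.
      have := lt_nbhsr s0; apply: filterS => x x0 /=.
      by rewrite in_itv/= andbT ltW.
    have hpz := is_derive_comp2 _ _ h s p z _ _ (dh _)
      (is_derive_in_is_derive _ _ _ _ _ nI dp)
      (is_derive_in_is_derive _ _ _ _ _ n0 (hz _ (ltW s0))).
    have dts := is_derive_in_is_derive _ _ _ _ _ nI dth.
    have dDs j := is_derive_in_is_derive _ _ _ _ _ nI
      (is_derive_in_sqdist _ _ _ _ (col j d) _ (dD j)).
    (* Writing [W] with operations on functions lets its derivative be inferred by the [is_derive]
       instances. *)
    have WE : W = (fun x => h (p x, z x)) - K *: ((cst ts - th) ^+ 2)
      - \sum_j Q j *: (fun x => dot (col j d - col j (D x)) (col j d - col j (D x))).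
      by apply/funext => x; rewrite /W fctE fct_sumE.
    eexists; first by rewrite WE; apply: is_deriveB.
    have := barrier_derivative_ge h psi alpha mu nu E Vz K ts (th s) s Q dbar
      (p s) (z s) _ (eps s) (zdot s) d (D s) halpha hmu hnu hK hQ hdbar tsb hd
      (heps _ (ltW s0)) (hzdot _ (ltW s0)) (hKbf _ Is).
    rewrite -/(W s) => /le_trans; apply.
    (* [subrK] restores [theta] from [ts + (1 + alpha) / 2]; the lower bound and the inferred
       derivative then agree term by term. *)
    rewrite subrK le_eqVlt; apply/predU1P; left.
    congr (_ + _); last first.
      rewrite -sumrN; apply: eq_bigr => j _.
      by rewrite scalerN opprK -[RHS]/(Q j * _); ring.
    congr (_ + _).
    by rewrite -[RHS]/(- (K * ((2 * (ts - th s) ^+ 1) * (0 - _)))); ring.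
(* [h] exceeds [W] by these weighted squares, so [0 <= W t] suffices. *)
have : 0 <= \sum_j Q j * dot (col j d - col j (D t)) (col j d - col j (D t)).
  by rewrite sumr_ge0// => j _; rewrite mulr_ge0 ?dot_ge0// ltW.
have : 0 <= K * (ts - th t) ^+ 2 by rewrite mulr_ge0 ?sqr_ge0// ltW.
by move: Wt; rewrite /W; lra.
Qed.
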